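(* Let $d\ge1$ and let $H_1,\dots,H_d$ be finite undirected graphs on a common vertex set $V$, and let $G$ be their intersection, i.e. $V(G)=V$ and $E(G)=\bigcap_{i=1}^d E(H_i)$. Then $s(G)<R(s(H_1)+1,s(H_2)+1,\dots,s(H_d)+1)$.
   Context: $s(H)$ denotes the number of leaves of a largest induced star (induced subgraph isomorphic to $K_{1,s}$) in $H$; when $|V(H)|\le 2$, $s(H)=1$ by convention. $R(n_1,\dots,n_c)$ is the multicolor Ramsey number: the least $t$ such that every coloring of the edges of $K_t$ with colors $1,\dots,c$ contains, for some $i$, a complete subgraph on $n_i$ vertices all of whose edges have color $i$. *)

(* Defs.v *)
From HB Require Import structures.
From mathcomp Require Import all_boot.

Set Implicit Arguments.
Unset Strict Implicit.
Unset Printing Implicit Defensive.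

Record sgraph (V : finType) := SGraph {
  adj :> rel V;
  adj_sym : symmetric adj;
  adj_irrefl : irreflexive adj }.

Definition edges (V : finType) (G : sgraph V) : {set {set V}} :=
  [set e : {set V} | [exists x, exists y, adj G x y && (e == [set x; y])]].

Lemma in_edges (V : finType) (G : sgraph V) (x y : V) :
  ([set x; y] \in edges G) = adj G x y.
Proof.
rewrite inE; apply/existsP/idP => [[u /existsP[v /andP[Guv /eqP exy]]]|Gxy].
  have uDv : u != v by apply: contraTneq Guv => ->; rewrite adj_irrefl.
  have: u \in [set x; y] by rewrite exy set21.
  have: v \in [set x; y] by rewrite exy set22.
  move: uDv Guv; rewrite !inE => uDv Guv.
  by case/orP=> /eqP vE; case/orP=> /eqP uE; subst u v;
    rewrite ?eqxx // in uDv *; rewrite // adj_sym.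
by exists x; apply/existsP; exists y; rewrite Gxy eqxx.
Qed.

Section Star.

Variable s : nat.

(* K_{1,s}: the centre is None, the leaves are Some i. *)
Definition star_rel : rel (option 'I_s) := fun x y => isSome x != isSome y.

Lemma star_sym : symmetric star_rel.
Proof. by move=> x y; rewrite /star_rel eq_sym. Qed.

Lemma star_irrefl : irreflexive star_rel.
Proof. by move=> x; rewrite /star_rel eqxx. Qed.

Definition star : sgraph (option 'I_s) := SGraph star_sym star_irrefl.

End Star.

Section Induced.

Variables (V : finType) (G : sgraph V) (A : {set V}).

Definition induced_rel : rel {x : V | x \in A} :=
  fun x y => adj G (val x) (val y).

Lemma induced_sym : symmetric induced_rel.
Proof. by move=> x y; rewrite /induced_rel adj_sym. Qed.

Lemma induced_irrefl : irreflexive induced_rel.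
Proof. by move=> x; rewrite /induced_rel adj_irrefl. Qed.

Definition induced : sgraph {x : V | x \in A} :=
  SGraph induced_sym induced_irrefl.

End Induced.

Definition isomorphic (V W : finType) (G : sgraph V) (H : sgraph W) : bool :=
  [exists f : {ffun V -> W}, exists g : {ffun W -> V},
    [&& [forall x, g (f x) == x], [forall y, f (g y) == y] &
        [forall x, forall y, adj H (f x) (f y) == adj G x y]]].

Definition has_induced_star (V : finType) (G : sgraph V) (s : nat) : bool :=
  [exists A : {set V}, isomorphic (induced G A) (star s)].

Lemma has_induced_star_bound (V : finType) (G : sgraph V) (s : nat) :
  has_induced_star G s -> s < #|V|.
Proof.
case/existsP=> A /existsP[f /existsP[g /and3P[_ /forallP fK _]]].
have g_inj : injective g by move=> x y /(congr1 f); rewrite !(eqP (fK _)).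
have := leq_card g g_inj; rewrite card_option card_ord card_sig => leqA.
by apply: leq_trans leqA _; apply: max_card.
Qed.

(* The range s < #|V| loses nothing, by has_induced_star_bound. Since K_{1,0}
   is a single vertex, an edgeless graph on at least 3 vertices gets 0. *)
Definition star_number (V : finType) (G : sgraph V) : nat :=
  if #|V| <= 2 then 1
  else \max_(s < #|V| | has_induced_star G s) s.

Definition kedge (t : nat) := {e : {set 'I_t} | #|e| == 2}.

Definition ramsey_arrow (c : nat) (n : 'I_c -> nat) (t : nat) : bool :=
  [forall k : {ffun kedge t -> 'I_c},
    exists i : 'I_c, exists S : {set 'I_t},
      (#|S| == n i) && [forall e : kedge t, (val e \subset S) ==> (k e == i)]].

(* Ramsey's theorem for a multicolouring k of pairs. Its finite form below makes
   the minimum in the definition of ramsey exist. *)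
Lemma ramsey_sets (c : nat) (n : 'I_c -> nat) :
  exists t, forall (T : finType) (k : {set T} -> 'I_c -> bool) (A : {set T}),
    (forall x y, x != y -> exists i, k [set x; y] i) -> t <= #|A| ->
    exists i, exists2 S : {set T}, #|S| = n i &
      S \subset A /\ {in S &, forall x y, x != y -> k [set x; y] i}.
Proof.
elim: {n}(\sum_i n i) {-2}n (erefl (\sum_i n i)) => [|N IHN] n sum_n.
  exists 2 => T k A k_tot A2; have /card_gt1P[x [y [_ _ xy]]] : 1 < #|A| by [].
  have [i _] := k_tot x y xy; exists i, set0; last first.
    by split=> [|u v]; rewrite ?sub0set ?inE.
  by move/eqP: sum_n; rewrite cards0 sum_nat_eq0 => /forallP/(_ i)/eqP->.
case: (pickP (fun i => n i == 0)) => [i0 /eqP ni0|n_gt0].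
  exists 0 => T k A _ _; exists i0, set0; first by rewrite cards0 ni0.
  by split=> [|u v]; rewrite ?sub0set ?inE.
pose n' i j := if j == i then (n j).-1 else n j.
have sum_n' i : \sum_j n' i j = N.
  apply: succn_inj; rewrite -sum_n (bigD1 i) //= [RHS](bigD1 i) //=.
  rewrite /n' eqxx -addSn prednK ?lt0n ?n_gt0 //; congr (_ + _).
  by apply: eq_bigr => j /negPf->.
have [t tP] := fin_all_exists (fun i => IHN (n' i) (sum_n' i)).
exists (\sum_i t i).+2 => T k A k_tot leA.
have /card_gt0P[v vA] : 0 < #|A| by apply: leq_trans leA.
pose B i := [set x in A :\ v | k [set v; x] i].
have AvB : A :\ v \subset \bigcup_i B i.
  apply/subsetP=> x xAv; have /k_tot[i ki] : v != x.
    by move: xAv; rewrite !inE eq_sym => /andP[].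
  by apply/bigcupP; exists i; rewrite // inE xAv.
have [i leB] : exists i, t i <= #|B i|.
  apply/existsP; apply: contraTT leA; rewrite negb_exists => /forallP ltB.
  rewrite -ltnNge (cardsD1 v) vA add1n !ltnS.
  apply: leq_trans (subset_leq_card AvB) _.
  have leU : #|\bigcup_i B i| <= \sum_i #|B i|.
    elim/big_rec2: _ => [|i m U _ leU]; first by rewrite cards0.
    by rewrite cardsU (leq_trans (leq_subr _ _)) ?leq_add2l.
  apply: leq_trans leU _; apply: leq_sum => i _.
  by rewrite ltnW // ltnNge.
have [j [S cardS [SB Sk]]] := tP i T k (B i) k_tot leB.
have BA : B i \subset A by apply/subsetP=> x; rewrite !inE => /andP[/andP[]].
move: cardS; rewrite /n'; case: eqP => [ji|_] cardS; last first.
  by exists j, S => //; split=> //; apply: subset_trans BA.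
subst j; exists i, (v |: S).
  have -> : #|v |: S| = (n i).-1.+1.
    rewrite cardsU1 cardS; case: (boolP (v \in S)) => // /(subsetP SB).
    by rewrite !inE eqxx.
  by rewrite prednK // lt0n n_gt0.
split; first by rewrite subUset sub1set vA (subset_trans SB).
have kv x : x \in S -> k [set v; x] i.
  by move/(subsetP SB); rewrite inE => /andP[].
move=> x y; rewrite !in_setU1 => /orP[/eqP->|xS] /orP[/eqP->|yS] xy.
- by rewrite eqxx in xy.
- exact: kv.
- by rewrite setUC kv.
- exact: Sk.
Qed.

Lemma ramsey_exists (c : nat) (n : 'I_c -> nat) : exists t, ramsey_arrow n t.
Proof.
have [t tP] := ramsey_sets n; exists t; apply/forallP=> k.
pose kb (s : {set 'I_t}) i := [exists e : kedge t, (val e == s) && (k e == i)].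
have kb_tot x y : x != y -> exists i, kb [set x; y] i.
  move=> xy; have exy : #|[set x; y]| == 2 by rewrite cards2 xy.
  pose e : kedge t := exist (fun e : {set 'I_t} => #|e| == 2) _ exy.
  by exists (k e); apply/existsP; exists e; rewrite !eqxx.
have [|i [S cardS [_ Sk]]] := tP _ kb setT kb_tot.
  by rewrite cardsT card_ord.
apply/existsP; exists i; apply/existsP; exists S; rewrite cardS eqxx /=.
apply/forallP=> e; apply/implyP=> eS.
have /cards2P[x [y [xy exy]]] := valP e.
move: eS; rewrite exy subUset !sub1set => /andP[xS yS].
have /existsP[e' /andP[/eqP ee' /eqP <-]] := Sk x y xS yS xy.
by apply/eqP; congr (k _); apply: val_inj; rewrite ee'.
Qed.

Definition ramsey (c : nat) (n : 'I_c -> nat) : nat := ex_minn (ramsey_exists n).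

(* Main.v *)
Require Import Defs.
From mathcomp Require Import all_boot.

(** Let c be the centre of an induced K_{1,s} of G, and suppose that
    R(s(H_1)+1, ..., s(H_d)+1) <= s. Two leaves are not adjacent in G, so they
    are not adjacent in some H_i: colour the pair by such an i. A monochromatic
    set of s(H_i)+1 leaves of colour i is independent in H_i, while c is adjacent
    in H_i to all of it: H_i has an induced star larger than s(H_i). *)

(** A concrete form free of subtypes and isomorphisms: from here on a star is a centre [c] with an
    injective family [l] of leaves. *)
Lemma has_induced_starP (V : finType) (G : sgraph V) (s : nat) :
  reflect (exists c : V, exists l : 'I_s -> V,
             [/\ injective l, forall i, adj G c (l i)
               & forall i j, ~~ adj G (l i) (l j)])
          (has_induced_star G s).
Proof.
apply: (iffP existsP) => [[A]|[c [l [l_inj c_l l_ind]]]].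
  case/existsP=> f /existsP[g /and3P[_ /forallP fK /forallP fG]].
  have adj_g u v : adj G (val (g u)) (val (g v)) = star_rel u v.
    have /forallP/(_ (g v))/eqP := fG (g u).
    by rewrite (eqP (fK u)) (eqP (fK v)).
  exists (val (g None)), (fun i => val (g (Some i))).
  split=> [i j /val_inj/(congr1 f)|i|i j]; rewrite ?adj_g //.
  by rewrite !(eqP (fK _)) => -[].
pose h u := if u is Some i then l i else c.
have adj_h u v : adj G (h u) (h v) = star_rel u v.
  case: u v => [i|] [j|] //=; last by rewrite adj_irrefl.
  - exact: negbTE.
  - by rewrite adj_sym c_l.
  - by rewrite c_l.
have cNl i : l i <> c by move=> li; have := c_l i; rewrite li adj_irrefl.
have h_inj : injective h.
  case=> [i|] [j|] //= hE; first by rewrite (l_inj _ _ hE).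
    by case: (cNl i).
  by case: (cNl j).
pose A := [set h u | u : option 'I_s].
have hA u : h u \in A by exact: imset_f.
pose g u : {x : V | x \in A} := exist (fun x => x \in A) (h u) (hA u).
have g_inj : injective g by move=> u v /(congr1 val)/h_inj.
(* [A] is the image of the injective [h], so [g] is an injection between types of equal size; its
   inverse [f] is the isomorphism sought. *)
have [|f gK fK] := inj_card_bij g_inj.
  by rewrite card_sig -[X in _ <= X](card_imset _ h_inj).
exists A; apply/existsP; exists (finfun f); apply/existsP; exists (finfun g).
apply/and3P; split; apply/forallP=> u.
- by rewrite !ffunE fK.
- by rewrite !ffunE gK.
- apply/forallP=> v; rewrite !ffunE -[in X in _ == X](fK u) -[in X in _ == X](fK v).
  by rewrite /= /induced_rel /= adj_h.
Qed.

Lemma has_induced_star_leq (V : finType) (G : sgraph V) (s t : nat) :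
  t <= s -> has_induced_star G s -> has_induced_star G t.
Proof.
move=> ts /has_induced_starP[c [l [l_inj c_l l_ind]]].
apply/has_induced_starP; exists c, (l \o widen_ord ts); split=> [i j|i|i j] //=.
by move/l_inj/(congr1 val) => ij; apply: val_inj.
Qed.

Lemma leq_star_number (V : finType) (G : sgraph V) (s : nat) :
  2 < #|V| -> has_induced_star G s -> s <= star_number G.
Proof.
rewrite /star_number ltnNge => /negPf-> Gs.
by rewrite (bigmax_sup (Ordinal (has_induced_star_bound Gs))).
Qed.

Lemma has_induced_star_number (V : finType) (G : sgraph V) :
  2 < #|V| -> has_induced_star G (star_number G).
Proof.
move=> V_gt2; have /card_gt0P[v _] : 0 < #|V| by apply: leq_trans V_gt2.
rewrite /star_number leqNgt V_gt2 /=.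
(* The default value 0 of the maximum is attained too: the single vertex [v] is a $K_{1,0}$. *)
elim/big_ind: _ => [|a b Ga Gb|i //]; last by rewrite /maxn; case: ifP.
by apply/has_induced_starP; exists v, (fun=> v); split; case.
Qed.

Lemma ramsey_arrow_ramsey (c : nat) (n : 'I_c -> nat) :
  ramsey_arrow n (ramsey n).
Proof. by rewrite /ramsey; case: ex_minnP. Qed.

(** Since [0 < c], a constant colouring exists, and its monochromatic set lies inside ['I_t]. This
    serves the case of at most two vertices. *)
Lemma ramsey_arrow_min (c : nat) (n : 'I_c -> nat) (t : nat) :
  0 < c -> ramsey_arrow n t -> exists i, n i <= t.
Proof.
move=> c_gt0 /forallP/(_ [ffun=> Ordinal c_gt0])/existsP[i /existsP[S]].
case/andP=> /eqP cardS _; exists i.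
by rewrite -cardS -[X in _ <= X]card_ord max_card.
Qed.

(** Here a pair may have several admissible colours, as a pair of leaves may be non-adjacent in
    several $H_i$; choosing one for each pair gives a true colouring. *)
Lemma ramsey_arrowP (c : nat) (n : 'I_c -> nat) (t : nat)
    (r : 'I_c -> rel 'I_t) :
    0 < c -> ramsey_arrow n t ->
    (forall i, symmetric (r i)) ->
    (forall x y, x != y -> exists i, r i x y) ->
  exists i, exists2 S : {set 'I_t},
    #|S| = n i & {in S &, forall x y, x != y -> r i x y}.
Proof.
move=> c_gt0 /forallP arr r_sym r_tot.
pose mono (e : {set 'I_t}) i :=
  [forall x in e, forall y in e, (x != y) ==> r i x y].
(* The default colour only makes [k] total: [r_tot] and the symmetry of [r] ensure that the pick
   succeeds. *)
pose k := [ffun e : kedge t =>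
  odflt (Ordinal c_gt0) [pick i | mono (val e) i]].
have k_mono e : mono (val e) (k e).
  rewrite ffunE; case: pickP => //= no_i.
  have /cards2P[x [y [xy exy]]] := valP e.
  have [i rxy] := r_tot x y xy; have /negP[] := no_i i.
  apply/forall_inP=> u; rewrite exy => ue; apply/forall_inP=> v ve.
  apply/implyP; move: ue ve; rewrite !inE.
  by case/orP=> /eqP-> /orP[]/eqP->; rewrite ?eqxx // r_sym.
have /existsP[i /existsP[S /andP[/eqP cardS /forallP kS]]] := arr k.
exists i, S => // x y xS yS xy.
have exy : #|[set x; y]| == 2 by rewrite cards2 xy.
pose e : kedge t := exist (fun e : {set 'I_t} => #|e| == 2) _ exy.
have /eqP ke : k e == i.
  by apply: (implyP (kS e)); rewrite subUset !sub1set xS yS.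
have := k_mono e; rewrite ke => /forall_inP/(_ x (set21 x y)).
by move=> /forall_inP/(_ y (set22 x y))/implyP; apply.
Qed.

Theorem theorem2p2 (d : nat) (hd : 0 < d) (V : finType)
    (H : 'I_d -> sgraph V) (G : sgraph V)
    (hG : edges G = \bigcap_(i < d) edges (H i)) :
  star_number G < ramsey (fun i : 'I_d => (star_number (H i)).+1).
Proof.
set n := fun i => _; have arr := ramsey_arrow_ramsey _ n.
have [V_le2|V_gt2] := leqP #|V| 2.
  (* By convention every star number is 1 here, so [n i] is 2 and the goal is that the Ramsey number
     is at least 2. *)
  have [i] := ramsey_arrow_min _ _ _ hd arr.
  by apply: leq_trans; rewrite /n /star_number V_le2.
have adjG x y : adj G x y = [forall i, adj (H i) x y].
  rewrite -in_edges hG; apply/bigcapP/forallP => GH i; first by rewrite -in_edges GH.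
  by rewrite in_edges.
rewrite ltnNge; apply/negP=> le_s.
(* The star is cut down to exactly [ramsey n] leaves, so that their indices are the vertices of the
   coloured complete graph. *)
have /has_induced_starP[c [l [l_inj c_l l_ind]]] :=
  has_induced_star_leq _ _ _ _ le_s (has_induced_star_number _ G V_gt2).
have c_lH i x : adj (H i) c (l x) by have := c_l x; rewrite adjG => /forallP.
pose r i x y := ~~ adj (H i) (l x) (l y).
have r_sym i : symmetric (r i) by move=> x y; rewrite /r adj_sym.
have r_tot x y : x != y -> exists i, r i x y.
  by move=> _; have := l_ind x y; rewrite adjG negb_forall => /existsP.
have [i [S cardS S_ind]] := ramsey_arrowP _ _ _ _ hd arr r_sym r_tot.
suff Hi : has_induced_star (H i) (n i).
  by have := leq_star_number _ _ _ V_gt2 Hi; rewrite ltnn.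
(* The new star keeps the centre [c]; its leaves are those indexed by [S], enumerated by
   [enum_val]. *)
apply/has_induced_starP; rewrite -cardS; exists c, (l \o enum_val).
split=> [x y|x|x y] /=; [by move/l_inj/enum_val_inj | exact: c_lH |].
have [->|xy] := eqVneq x y; first by rewrite adj_irrefl.
by apply: S_ind; rewrite ?enum_valP // (inj_eq enum_val_inj).
Qed.
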